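(* Let $k$ be an infinite field, let $n,m\ge 1$ be integers, and let $R=k[x_1,\ldots,x_n,y_1,\ldots,y_m]$ be bigraded by $\deg x_i=(1,0)$ and $\deg y_j=(0,1)$. Let $H:\mathbb N\times\mathbb N\to\mathbb N$ be a numerical function. Then the following are equivalent: 1) $H$ is a fractal function (with respect to $n$ and $m$); 2) $H=H_{R/I}$ for some bilex ideal $I\subseteq R$.
   Context: Here $\mathbb N=\{0,1,2,\ldots\}$. **Hilbert function.** $R_{(i,j)}$ is the $k$-vector space of bihomogeneous elements of bidegree $(i,j)$. An ideal $I\subseteq R$ is bigraded if it is generated by bihomogeneous elements, and $I_{(i,j)}=I\cap R_{(i,j)}$. The Hilbert function of $R/I$ is $H_{R/I}(i,j)=\dim_k R_{(i,j)}-\dim_k I_{(i,j)}$. **Bilex ideals.** Monomials of $R$ are ordered by the degree lexicographic order induced by $x_n>\cdots>x_1>y_m>\cdots>y_1$. A set of monomials $L\subseteq R_{(i,j)}$ is called bilex if for every monomial $uv\in L$, with $u\in R_{(i,0)}$ and $v\in R_{(0,j)}$ monomials: (a) if $u'\in R_{(i,0)}$ is a monomial with $u'>u$, then $u'v\in L$; (b) if $v'\in R_{(0,j)}$ is a monomial with $v'>v$, then $uv'\in L$. A monomial ideal $I\subseteq R$ is a bilex ideal if for all $i,j\ge 0$ the space $I_{(i,j)}$ is generated as a $k$-vector space by a bilex set of monomials. **Expansions of sequences.** For a positive integer $a$ let $[a]=(1,2,\ldots,a)$. For a sequence of positive integers $\sigma=(s_1,s_2,\ldots)$ let $[\sigma]$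 be the concatenation of $[s_1],[s_2],\ldots$ in this order. For a positive integer $a$ put $[a]^0=(a)$ and $[a]^d=[[a]^{d-1}]$ for $d\ge1$. For example $[3]^2=(1,1,2,1,2,3)$. The sequence $[n]^d$ has $\binom{d+n-1}{d}$ entries, whose sum is $\binom{d+n}{d+1}$. **Ferrers matrices.** A Ferrers matrix of size $(a,b)$ is an $a\times b$ matrix $M=(m_{st})$ with entries in $\{0,1\}$ such that $m_{st}=1$ implies $m_{s't'}=1$ for all $s'\le s$, $t'\le t$. The set of these is denoted $\mathcal F^{a\times b}$. $\sum M$ denotes the sum of all entries of $M$. For $M,N\in\mathcal F^{a\times b}$, $M\le N$ means entrywise inequality. **Expansions of matrices.** For an $a\times b$ matrix $M$ and $\mathbf v=(v_1,\ldots,v_a)\in\mathbb N^a$, $\mathbf w=(w_1,\ldots,w_b)\in\mathbb N^b$: $M^{\langle \mathbf v,\bullet\rangle}$ is the $(\sum_s v_s)\times b$ matrix obtained by repeating the $s$-th row of $M$ $v_s$ times, for $s=1,\ldots,a$ (in order); $M^{\langle\bullet,\mathbf w\rangle}$ is the $a\times(\sum_t w_t)$ matrix obtained by repeating the $t$-th column of $M$ $w_t$ times, for $t=1,\ldots,b$ (in order). **Fractal functions.** $H:\mathbb N^2\to\mathbb N$ is a fractal function (with respect to $n,m$) if $H(0,0)=1$ and for every $(i,j)\in\mathbb N^2$ there is a matrix $M_{ij}\in\mathcal F^{\binom{i-1+n}{n-1}\times\binom{j-1+m}{m-1}}$ with $\sum M_{ij}=H(i,j)$, such that all these matrices satisfy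 $$M_{ij}\le M_{i-1,j}^{\langle [n]^{i-1},\bullet\rangle}\ \text{ if } i>0,\qquad M_{ij}\le M_{i,j-1}^{\langle\bullet,[m]^{j-1}\rangle}\ \text{ if } j>0.$$
   Formalization: The bilex ideal I is required to be proper: I = R is bilex with H = 0, which is not fractal since H(0,0) must be 1. Membership in I is taken to be decidable, which excluded middle supplies. *)

(* Defs.v *)
From HB Require Import structures.
From mathcomp Require Import all_boot all_order all_algebra.
From mathcomp.multinomials Require Import mpoly.

Set Implicit Arguments.
Unset Strict Implicit.
Unset Printing Implicit Defensive.

Import GRing.Theory.

Local Open Scope ring_scope.

Definition infinite_field (k : fieldType) : Prop :=
  forall s : seq k, exists x : k, x \notin s.

Section LinearAlgebra.
Variables (K : nzRingType) (V : lmodType K).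

Definition in_span (S : V -> Prop) (v : V) : Prop :=
  exists s : seq (K * V),
    (forall x, x \in s -> S x.2) /\ v = \sum_(x <- s) x.1 *: x.2.

(* The subset A is a subspace with a basis of d vectors. *)
Definition has_dim (A : {pred V}) (d : nat) : Prop :=
  exists b : 'I_d -> V,
    (forall v, v \in A <-> exists c : 'I_d -> K, v = \sum_i c i *: b i) /\
    (forall c : 'I_d -> K, \sum_i c i *: b i = 0 -> forall i, c i = 0).

End LinearAlgebra.

Section BigradedRing.
Variables (k : fieldType) (n m : nat).

(* R = k[x_1, ..., x_n, y_1, ..., y_m] is {mpoly k[n + m]}, where 'X_(lshift m s)
   stands for x_(n - s) and 'X_(rshift n t) for y_(m - t) (s < n, t < m).
   The order of mpoly on monomials is the degree lexicographic order in which
   the variable of index 0 is the largest; with this numbering it is the one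
   induced by x_n > ... > x_1 > y_m > ... > y_1. *)
Implicit Types u v : 'X_{1..n + m}.

Definition bideg u : nat * nat :=
  (\sum_(s < n) u (lshift m s), \sum_(t < m) u (rshift n t))%N.

Definition bihomog (i j : nat) : {pred {mpoly k[n + m]}} :=
  [pred p | all (fun u => bideg u == (i, j)) (msupp p)].

Definition ideal_part (I : {pred {mpoly k[n + m]}}) (i j : nat) :
    {pred {mpoly k[n + m]}} :=
  [predI I & bihomog i j].

(* H is the Hilbert function of R / I. *)
Definition is_hilbert_function (I : {pred {mpoly k[n + m]}})
    (H : nat -> nat -> nat) : Prop :=
  forall i j, exists dR dI : nat,
    [/\ has_dim (bihomog i j) dR, has_dim (ideal_part I i j) dI
      & H i j = (dR - dI)%N].

Definition monomials_in (L : 'X_{1..n + m} -> Prop) (p : {mpoly k[n + m]}) :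
    Prop :=
  exists2 u, L u & p = 'X_[u].

(* Spans over R^o are the ideals generated by the given elements. *)
Definition generated_by_monomials (I : {pred {mpoly k[n + m]}}) : Prop :=
  exists G : 'X_{1..n + m} -> Prop,
    forall p, p \in I <->
      @in_span {mpoly k[n + m]} {mpoly k[n + m]}^o (monomials_in G) p.

Definition bilex_set (i j : nat) (L : 'X_{1..n + m} -> Prop) : Prop :=
  (forall w, L w -> bideg w = (i, j)) /\
  forall u v, bideg u = (i, 0%N) -> bideg v = (0%N, j) -> L (u + v)%MM ->
    (forall u', bideg u' = (i, 0%N) -> (u < u')%O -> L (u' + v)%MM) /\
    (forall v', bideg v' = (0%N, j) -> (v < v')%O -> L (u + v')%MM).

(* idealr_closed asks for a proper ideal.  The unit ideal has to be excluded:
   its Hilbert function is 0, whereas fractal functions have H 0 0 = 1. *)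
Definition bilex_ideal (I : {pred {mpoly k[n + m]}}) : Prop :=
  [/\ idealr_closed I, generated_by_monomials I
    & forall i j, exists2 L : 'X_{1..n + m} -> Prop, bilex_set i j L &
        forall p, p \in ideal_part I i j <-> in_span (monomials_in L) p].

End BigradedRing.

Definition seq_expand (sigma : seq nat) : seq nat :=
  flatten [seq iota 1 s | s <- sigma].

(* [a]^d *)
Definition bracket_exp (a d : nat) : seq nat := iter d seq_expand [:: a].

Section Matrices.
Variables (a b : nat).
Implicit Type M : 'M[bool]_(a, b).

Definition ferrers M : Prop :=
  forall (s s' : 'I_a) (t t' : 'I_b),
    (s' <= s)%N -> (t' <= t)%N -> M s t -> M s' t'.

Definition mx_sum M : nat := (\sum_s \sum_t M s t)%N.

Definition row_expand M (v : 'I_a -> nat) : 'M[bool]_(\sum_s v s, b) :=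
  \mxcol_(s < a) (\matrix_(r < v s, t < b) M s t).

Definition col_expand M (w : 'I_b -> nat) : 'M[bool]_(a, \sum_t w t) :=
  \mxrow_(t < b) (\matrix_(s < a, r < w t) M s t).

End Matrices.

(* Entrywise comparison of matrices of provably, but not definitionally, equal
   sizes. *)
Definition mx_le a b a' b' (M : 'M[bool]_(a, b)) (N : 'M[bool]_(a', b')) : Prop :=
  exists e : (a' = a) * (b' = b), forall s t, M s t ==> castmx e N s t.

Definition fractal (n m : nat) (H : nat -> nat -> nat) : Prop :=
  H 0%N 0%N = 1%N /\
  exists M : forall i j : nat,
      'M[bool]_('C(i + n.-1, n.-1), 'C(j + m.-1, m.-1)),
    [/\ forall i j, ferrers (M i j) /\ mx_sum (M i j) = H i j,
        forall i j, mx_le (M i.+1 j)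
          (row_expand (M i j) (fun s => nth 0%N (bracket_exp n i) s))
      & forall i j, mx_le (M i j.+1)
          (col_expand (M i j) (fun t => nth 0%N (bracket_exp m j) t))].

(* Main.v *)
Require Import Defs.
From mathcomp Require Import all_boot all_order all_algebra.
From mathcomp.multinomials Require Import mpoly.

Set Implicit Arguments.
Unset Strict Implicit.
Unset Printing Implicit Defensive.

Import Order.TTheory.

(* List the monomials of degree d in x_1, ..., x_n increasingly.  Each monomial
   of degree d + 1 is a monomial u of degree d times a variable not larger than
   the smallest variable of u; listing these "children" of the successive u
   gives the increasing list in degree d + 1, and the number of children of the
   s-th monomial is the s-th entry of [n]^d.  Index the rows and columns of M_ij
   by the x- and y-monomials of degrees i and j, with entry 1 where the product
   lies outside I.  Then the Ferrers condition is bilexity, and the comparison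
   with the expanded matrix says that the children of an element of I lie in I.
   For lex sets this already gives closure under all x_k: the parent of x_k u
   is at least u. *)

(** * Expansions of sequences and their lengths *)

Lemma nth_sum_sumn (s : seq nat) : \sum_(i < size s) nth 0 s i = sumn s.
Proof. by rewrite sumnE (big_nth 0) big_mkord. Qed.

(** Without repetitions, [index] finds [y] exactly at the place where the block [f x] puts it, so
    the block number can be read off. With [f] listing children, this recovers the parent of a
    monomial. *)
Lemma index_flatten (S T : eqType) (f : S -> seq T) (s : seq S) x y :
  uniq (flatten (map f s)) -> x \in s -> y \in f x ->
  reshape_index (map (size \o f) s) (index y (flatten (map f s))) = index x s.
Proof.
move=> U xs yf.
have sh : shape (map f s) = map (size \o f) s by rewrite /shape -map_comp.
have ixs : index x s < size s by rewrite index_mem.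
have lt : index y (f x) < nth 0 (map (size \o f) s) (index x s).
  by rewrite (nth_map x) //= nth_index // index_mem.
rewrite -[in index y _](_ : nth y (flatten (map f s))
    (flatten_index (map (size \o f) s) (index x s) (index y (f x))) = y).
  rewrite index_uniq ?flatten_indexKl // size_flatten sh.
  exact: flatten_indexP.
rewrite nth_flatten sh flatten_indexKl // flatten_indexKr // (nth_map x) //.
by rewrite !nth_index.
Qed.

Lemma seq_expand_cat s t : seq_expand (s ++ t) = seq_expand s ++ seq_expand t.
Proof. by rewrite /seq_expand map_cat flatten_cat. Qed.

Lemma iter_seq_expand_cat d s t :
  iter d seq_expand (s ++ t) = iter d seq_expand s ++ iter d seq_expand t.
Proof. by elim: d => //= d ->; rewrite seq_expand_cat. Qed.

(** Expand the innermost sequence first: [iota 1 a.+1] is [iota 1 a] followed by [a.+1], and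
    expansion respects concatenation. On lengths this becomes Pascal's rule. *)
Lemma bracket_exp_succ a d :
  bracket_exp a.+1 d.+1 = bracket_exp a d.+1 ++ bracket_exp a.+1 d.
Proof.
rewrite /bracket_exp !iterSr /seq_expand /= !cats0.
rewrite -iter_seq_expand_cat -[_ :: iota 2 a]/(iota 1 a.+1).
by rewrite -[in iota 1 a.+1](addn1 a) iotaD add1n.
Qed.

Lemma size_bracket_exp a d : size (bracket_exp a.+1 d) = 'C(d + a, a).
Proof.
elim: a d => [|a IHa] d.
  rewrite bin0; elim: d => // d IHd; rewrite bracket_exp_succ size_cat IHd.
  (* The summand $[0]^{d+1}$ is empty, so the length stays 1. *)
  rewrite /bracket_exp iterSr /seq_expand /= (_ : iter d _ [::] = [::]) //.
  by elim: (d) => //= e ->.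
elim: d => [|d IHd]; first by rewrite add0n binn.
by rewrite bracket_exp_succ size_cat IHd IHa [in RHS]addSn binS addSnnS addnC.
Qed.

Lemma sumn_bracket_exp a d : sumn (bracket_exp a d) = size (bracket_exp a d.+1).
Proof.
rewrite /bracket_exp iterS /seq_expand size_flatten /shape -map_comp.
by congr sumn; rewrite -[LHS]map_id; apply: eq_map => s /=; rewrite size_iota.
Qed.

(** * Monomials of a given degree in increasing order *)

Section Monomials.
Variable n : nat.
Implicit Types u w : 'X_{1..n}.

(* As the variable of largest index is the smallest one, this is the position
   of the smallest variable dividing u (and 0 for u = 1). *)
Definition top u : nat := \max_(k < n | u k != 0) k.

Lemma leq_top u (k : 'I_n) : u k != 0 -> k <= top u.
Proof. exact: (@leq_bigmax_cond _ (fun k : 'I_n => u k != 0) val). Qed.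

Lemma top_support u : u != 0%MM -> exists2 k : 'I_n, u k != 0 & top u = k.
Proof.
move=> u0; have : 0 < #|[pred k | u k != 0]|.
  rewrite lt0n; apply: contraNneq u0 => /card0_eq z; apply/eqP/mnmP => k.
  by rewrite mnmE; have := z k; rewrite inE => /negbFE/eqP.
by case/(eq_bigmax_cond val) => k kP e; exists k => //; rewrite -[RHS]e; apply: eq_bigl.
Qed.

Lemma top0 : top 0%MM = 0.
Proof. by rewrite /top big_pred0 // => k; rewrite mnmE eqxx. Qed.

Lemma topDU u (k : 'I_n) : top u <= k -> top (u + U_(k))%MM = k.
Proof.
move=> uk; apply/eqP; rewrite eqn_leq leq_top ?andbT; last first.
  by rewrite mnmDE mnm1E eqxx addn1.
apply/bigmax_leqP => l; rewrite mnmDE mnm1E; have [->//|_] := eqVneq k l.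
by rewrite addn0 => /leq_top/leq_trans->.
Qed.

(** Divide by the smallest variable of [u]. The quotient is the parent of [u], whose own smallest
    variable is at least as large. *)
Lemma top_factor u : u != 0%MM -> exists w (k : 'I_n), u = (w + U_(k))%MM /\ top w <= k.
Proof.
move=> /top_support[k uk tu]; exists (u - U_(k))%MM, k; split.
  rewrite submK //; apply/mnm_lepP => l; rewrite mnm1E.
  by have [<-|//] := eqVneq k l; rewrite lt0n.
rewrite -tu; apply/bigmax_leqP => l lP; apply: leq_top.
by apply: contraNneq lP => z; rewrite mnmE z.
Qed.

Lemma lt_mnm1 (k l : 'I_n) : k < l -> (U_(l)%MM < U_(k)%MM :> 'X_{1..n})%O.
Proof.
move=> kl; apply/ltmcP; first by rewrite !mdeg1.
exists k => [j jk|]; rewrite !mnm1E ?eqxx -!val_eqE /= ?(gtn_eqF kl) //.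
by rewrite (gtn_eqF jk) (gtn_eqF (ltn_trans jk kl)).
Qed.

(** Removing the smallest variable leaves the largest quotient: $k\le l$ means that variable [k] is
    at least variable [l], so $w<u$ would make the two products differ. *)
Lemma le_top_factor u w (k l : 'I_n) :
  (u + U_(k) = w + U_(l))%MM -> top w <= l -> (u <= w)%O.
Proof.
move=> e wl; rewrite leNgt; apply/negP => wu.
have kl : k <= l by rewrite -(topDU wl) -e leq_top // mnmDE mnm1E eqxx addn1.
have le : (U_(l)%MM <= U_(k)%MM :> 'X_{1..n})%O.
  by have := kl; rewrite leq_eqVlt => /predU1P[/val_inj->//|/lt_mnm1/ltW].
by have := ltmc_le_add wu le; rewrite e ltxx.
Qed.

(** The enumeration is reversed because a larger index is a smaller variable; the list is thus
    increasing. *)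
Definition children u : seq 'X_{1..n} :=
  [seq (u + U_(k))%MM | k <- rev [seq k : 'I_n <- enum 'I_n | top u <= k]].

Lemma childrenP u w :
  reflect (exists2 k : 'I_n, top u <= k & w = (u + U_(k))%MM) (w \in children u).
Proof.
apply: (iffP mapP) => -[k kP ->]; exists k => //; move: kP;
  by rewrite mem_rev mem_filter mem_enum andbT.
Qed.

(** The tops of the successive children run down from $n-1$ to [top u], and a monomial [w] has
    [n - top w] children. This is one step of the expansion of sequences. *)
Lemma sizes_children u : [seq n - top w | w <- children u] = iota 1 (n - top u).
Proof.
have -> : [seq n - top w | w <- children u] =
    rev [seq n - k | k <- [seq k <- iota 0 n | top u <= k]].
  rewrite -val_enum_ord filter_map -map_comp -map_rev /children -map_comp.
  apply/eq_in_map => k; rewrite mem_rev mem_filter => /andP[uk _] /=.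
  by rewrite topDU.
(* The first case arises only for [n = 0], since [top u] is otherwise the index of a variable. *)
have [nu|un] := leqP n (top u).
  rewrite (_ : n - top u = 0); last by apply/eqP.
  rewrite (eq_in_filter (a2 := pred0)) ?filter_pred0 // => k.
  by rewrite mem_iota => /andP[_ kn]; apply/negbTE; rewrite -ltnNge (leq_trans kn).
rewrite -[in iota 0 n](subnKC (ltnW un)) iotaD filter_cat add0n.
rewrite (eq_in_filter (a2 := pred0)) => [|k]; last first.
  by rewrite mem_iota => /andP[_ ku]; apply/negbTE; rewrite -ltnNge.
rewrite filter_pred0 (eq_in_filter (a2 := predT)) => [|k]; last first.
  by rewrite mem_iota => /andP[->].
rewrite filter_predT cat0s; apply: (@eq_from_nth _ 0) => [|i].
  by rewrite size_rev size_map !size_iota.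
rewrite size_rev size_map size_iota => iu.
rewrite nth_rev ?size_map ?size_iota // (nth_map 0) ?size_iota; last first.
  by rewrite -subSn // subSS leq_subr.
rewrite !nth_iota //; last by rewrite -subSn // subSS leq_subr.
by rewrite subnDA subKn // add1n.
Qed.

Lemma size_children u : size (children u) = n - top u.
Proof. by rewrite -[RHS](size_iota 1) -sizes_children size_map. Qed.

(** Let [p] be the first index where the exponents differ. Both added variables have index at least
    [p], and the one added to the smaller monomial lies strictly beyond [p], so the comparison at
    [p] survives. *)
Lemma children_lt u u' w w' : mdeg u = mdeg u' -> (u < u')%O ->
  w \in children u -> w' \in children u' -> (w < w')%O.
Proof.
move=> du uu' /childrenP[k uk ->] /childrenP[l u'l ->].
rewrite ltNge; apply/negP => le.
have [p eqp ltp] := ltmcP du uu'.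
have lp : p <= l.
  by apply: leq_trans u'l; apply: leq_top; rewrite -lt0n (leq_trans _ ltp).
(* Otherwise [top u] is at most [p], so [u] has no exponents after [p]; then it is bounded by [u']
   everywhere and strictly at [p], against equality of degrees. *)
have pk : p < k.
  apply: leq_trans uk; rewrite ltnNge; apply/negP => up.
  suff : mdeg u < mdeg u' by rewrite du ltnn.
  rewrite !mdegE (bigD1 p) //= [X in _ < X](bigD1 p) //= -addSn leq_add //.
  apply: leq_sum => j jp; have [/eqp->//|pj] := ltnP j p.
  have {}pj : p < j by rewrite ltn_neqAle eq_sym pj andbT.
  have [->//|/leq_top uj] := eqVneq (u j) 0.
  by have := leq_trans pj (leq_trans uj up); rewrite ltnn.
suff : ((u + U_(k))%MM < (u' + U_(l))%MM)%O by rewrite ltNge le.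
apply/ltmcP; first by rewrite !mdegD !mdeg1 du.
exists p => [j jp|]; rewrite !mnmDE !mnm1E -!val_eqE /=.
  by rewrite eqp // (gtn_eqF (ltn_trans jp pk)) (gtn_eqF (leq_trans jp lp)).
by rewrite (gtn_eqF pk) addn0 (leq_trans ltp) // leq_addr.
Qed.

Lemma children_pairwise u : pairwise <%O (children u).
Proof.
rewrite pairwise_map -sorted_pairwise; last by move=> x y z; apply: lt_trans.
rewrite rev_sorted; apply: (@sub_sorted _ (relpre val ltn)) => [k l kl /=|].
  by rewrite ltmc_add2r lt_mnm1.
apply: sorted_filter => [x y z /=|]; first exact: ltn_trans.
by rewrite -sorted_map val_enum_ord iota_ltn_sorted.
Qed.

Fixpoint mons d : seq 'X_{1..n} :=
  if d is d'.+1 then flatten (map children (mons d')) else [:: 0%MM].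

Lemma mem_mons d w : (w \in mons d) = (mdeg w == d).
Proof.
elim: d w => [|d IHd] w; first by rewrite inE mdeg_eq0.
apply/flatten_mapP/idP => [[u ud /childrenP[k _ ->]]|wd].
  by rewrite mdegD mdeg1 addn1 eqSS -IHd.
have /top_factor[u [k [wE uk]]] : w != 0%MM by rewrite -mdeg_eq0 (eqP wd).
exists u; last by apply/childrenP; exists k.
by move: wd; rewrite IHd wE mdegD mdeg1 addn1 eqSS.
Qed.

Lemma mdeg_mons d w : w \in mons d -> mdeg w = d.
Proof. by rewrite mem_mons => /eqP. Qed.

Lemma mons_pairwise d : pairwise <%O (mons d).
Proof.
(* The degrees are carried through the induction on the list, because [children_lt] compares
   children of monomials of the same degree. *)
elim: d => //= d; have := @mdeg_mons d.
elim: (mons d) => //= u s IHs degs /andP[us /IHs IH].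
rewrite pairwise_cat children_pairwise IH ?andbT; last first.
  by move=> w ws; rewrite degs // inE ws orbT.
apply/allrelP => w w' wu /flatten_mapP[u' u's w'u']; move: wu w'u'.
apply: children_lt; last exact: (allP us).
by rewrite !degs ?mem_head // inE u's orbT.
Qed.

Lemma mons_uniq d : uniq (mons d).
Proof. by apply: pairwise_uniq (mons_pairwise d) => u; rewrite ltxx. Qed.

Lemma index_mons_le d u w : u \in mons d -> w \in mons d ->
  (index u (mons d) <= index w (mons d)) = (u <= w)%O.
Proof.
move=> ud wd; have le a b : a \in mons d -> b \in mons d ->
    index a (mons d) < index b (mons d) -> (a < b)%O.
  move=> ad bd ab; rewrite -(nth_index 0%MM ad) -[X in (_ < X)%O](nth_index 0%MM bd).
  by have /(pairwiseP 0%MM) := mons_pairwise d; apply => //; rewrite inE index_mem.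
have [uw|wu|/index_inj->//] := ltngtP (index u (mons d)) (index w (mons d)).
- by rewrite ltW // le.
- by apply/esym/negbTE; rewrite -ltNge le.
- by rewrite lexx.
Qed.

Lemma bracket_expE d : bracket_exp n d = [seq n - top u | u <- mons d].
Proof.
elim: d => [|d IHd]; first by rewrite /= top0 subn0.
rewrite /bracket_exp iterS -/(bracket_exp n d) IHd /seq_expand -map_comp /=.
rewrite map_flatten -map_comp; congr flatten.
by apply: eq_map => u /=; rewrite sizes_children.
Qed.

Lemma size_mons d : 0 < n -> size (mons d) = 'C(d + n.-1, n.-1).
Proof.
move=> n0; rewrite -(size_map (fun u => n - top u)) -bracket_expE.
by rewrite -size_bracket_exp prednK.
Qed.

(** [reshape_index] sends a row or column of an expanded matrix to the one it repeats, so matrix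
    expansion becomes passage to the parent. *)
Lemma index_parent d u (k : 'I_n) : u \in mons d -> top u <= k ->
  reshape_index (bracket_exp n d) (index (u + U_(k))%MM (mons d.+1)) =
  index u (mons d).
Proof.
move=> ud uk; rewrite bracket_expE -(eq_map size_children).
apply: (index_flatten (mons_uniq d.+1)) => //.
by apply/childrenP; exists k.
Qed.

(** [A] plays the role of the monomials outside a lex ideal, hence closure downwards in each degree
    and under division by variables. *)
Definition lex_closed (A : pred 'X_{1..n}) :=
  (forall u u', mdeg u = mdeg u' -> (u <= u')%O -> A u' -> A u) /\
  (forall u (k : 'I_n), A (u + U_(k))%MM -> A u).

(** On positions, division is tested only for passage to the parent. This is enough: the parent of
    [u + U_(k)] is at least [u] by [le_top_factor], and monotonicity brings [A] down to [u]. *)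
Lemma lex_closed_nthP (A : pred 'X_{1..n}) :
  (forall d r r', r <= r' -> r' < size (mons d) ->
     A (nth 0%MM (mons d) r') -> A (nth 0%MM (mons d) r)) /\
  (forall d r, r < size (mons d.+1) -> A (nth 0%MM (mons d.+1) r) ->
     A (nth 0%MM (mons d) (reshape_index (bracket_exp n d) r))) <->
  lex_closed A.
Proof.
split=> -[mono step]; split.
- move=> u u' du uu'; have ud : u \in mons (mdeg u') by rewrite mem_mons du.
  have u'd : u' \in mons (mdeg u') by rewrite mem_mons.
  move=> Au'; rewrite -(nth_index 0%MM ud).
  apply: (mono _ _ (index u' (mons (mdeg u')))); rewrite ?nth_index ?index_mem //.
  by rewrite index_mons_le.
- move=> u k; set w := (u + U_(k))%MM => Aw.
  have /top_factor[p [l [wE pl]]] : w != 0%MM by rewrite -mdeg_eq0 mdegD mdeg1 addn1.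
  have dp : mdeg p = mdeg u.
    by have /eqP := congr1 mdeg wE; rewrite !mdegD !mdeg1 eqn_add2r => /eqP.
  have pd : p \in mons (mdeg u) by rewrite mem_mons dp.
  have ud : u \in mons (mdeg u) by rewrite mem_mons.
  have wd : w \in mons (mdeg u).+1 by rewrite mem_mons mdegD mdeg1 addn1.
  have : A p.
    rewrite -(nth_index 0%MM pd) -(index_parent pd pl) -wE.
    by apply: step; rewrite ?index_mem // nth_index.
  move=> Ap; rewrite -(nth_index 0%MM ud).
  apply: (mono _ _ (index p (mons (mdeg u)))); rewrite ?nth_index ?index_mem //.
  by rewrite index_mons_le // (le_top_factor wE).
- move=> d r r' rr' r'd; have rd := leq_ltn_trans rr' r'd; apply: mono.
    by rewrite !(@mdeg_mons d) // mem_nth.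
  by rewrite -(@index_mons_le d) ?mem_nth // !index_uniq ?mons_uniq.
- move=> d r rd; have /flatten_mapP[u ud wu] := mem_nth 0%MM rd.
  have /childrenP[k uk wE] := wu; rewrite wE => /step.
  by rewrite -{1}(index_uniq 0%MM rd (mons_uniq _)) wE (index_parent ud uk) nth_index.
Qed.

End Monomials.

(** * Ferrers matrices and sets of standard monomials *)

Section MatrixEntries.

(** Indexing by natural numbers, with [false] outside the matrix, allows matrices of only provably
    equal sizes to be compared without casts. *)
Definition mxget a b (M : 'M[bool]_(a, b)) (s t : nat) : bool :=
  if insub s is Some s' then if insub t is Some t' then M s' t' else false
  else false.

Lemma mxget_ord a b (M : 'M[bool]_(a, b)) (s : 'I_a) (t : 'I_b) :
  mxget M s t = M s t.
Proof. by rewrite /mxget !valK. Qed.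

Lemma mxgetP a b (M : 'M[bool]_(a, b)) s t : mxget M s t ->
  exists (s' : 'I_a) (t' : 'I_b), [/\ s = s', t = t' & M s' t'].
Proof.
rewrite /mxget; case: insubP => // s' _ <-; case: insubP => // t' _ <-.
by exists s', t'.
Qed.

Lemma ferrers_mxget a b (M : 'M[bool]_(a, b)) s t s' t' : ferrers M ->
  s' <= s -> t' <= t -> mxget M s t -> mxget M s' t'.
Proof.
move=> FM ss tt /mxgetP[s0 [t0 [es et]]].
have ls : s' < a by rewrite (leq_ltn_trans ss) // es.
have lt : t' < b by rewrite (leq_ltn_trans tt) // et.
rewrite -[s']/(val (Ordinal ls)) -[t']/(val (Ordinal lt)) mxget_ord.
by apply: FM; rewrite /= -?es -?et.
Qed.

(** Block matrices locate a row by [tagnat.sig1], sequences by [reshape_index]; both invert the map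
    from block and offset to position, where a block starts at the sum of the earlier sizes. *)
Lemma sig1_reshape_index (sigma : seq nat) a (w : 'I_a -> nat) :
    size sigma = a -> w =1 (fun s => nth 0 sigma s) ->
  forall r : 'I_(\sum_s w s), tagnat.sig1 r = reshape_index sigma r :> nat.
Proof.
move=> sa we r; have lt : tagnat.sig2 r < nth 0 sigma (tagnat.sig1 r).
  by rewrite -we.
rewrite -[LHS](flatten_indexKl lt); congr reshape_index.
rewrite [RHS]tagnat.rect /flatten_index; congr (_ + _).
rewrite sumnE (big_nth 0) big_mkord size_take sa ltn_ord.
rewrite (big_ord_widen_cond a predT
  (fun s => nth 0 (take (tagnat.sig1 r) sigma) s)) ?(ltnW (ltn_ord _)) //=.
by apply: eq_bigr => s sr; rewrite nth_take // we.
Qed.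

Lemma mx_le_row_expandP a b a' (N : 'M[bool]_(a, b)) (M : 'M[bool]_(a', b)) sigma :
    size sigma = a -> sumn sigma = a' ->
  mx_le M (row_expand N (fun s => nth 0 sigma s)) <->
  forall s t, mxget M s t -> mxget N (reshape_index sigma s) t.
Proof.
move=> sa sa'; split=> [[[e1 e2] le] s t /mxgetP[s' [t' [-> -> Mst]]]|le].
  have /implyP/(_ Mst) := le s' t'.
  rewrite castmxE !mxE -mxget_ord (sig1_reshape_index sa) //=.
have e : \sum_(s < a) nth 0 sigma s = a' by rewrite -sa nth_sum_sumn.
exists (e, erefl) => s t; apply/implyP => Mst.
rewrite castmxE !mxE -mxget_ord (sig1_reshape_index sa) //=.
by apply: le; rewrite mxget_ord.
Qed.

Lemma mx_le_col_expandP a b b' (N : 'M[bool]_(a, b)) (M : 'M[bool]_(a, b')) sigma :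
    size sigma = b -> sumn sigma = b' ->
  mx_le M (col_expand N (fun t => nth 0 sigma t)) <->
  forall s t, mxget M s t -> mxget N s (reshape_index sigma t).
Proof.
move=> sb sb'; split=> [[[e1 e2] le] s t /mxgetP[s' [t' [-> -> Mst]]]|le].
  have /implyP/(_ Mst) := le s' t'.
  rewrite castmxE !mxE -mxget_ord (sig1_reshape_index sb) //=.
have e : \sum_(t < b) nth 0 sigma t = b' by rewrite -sb nth_sum_sumn.
exists (erefl, e) => s t; apply/implyP => Mst.
rewrite castmxE !mxE -mxget_ord (sig1_reshape_index sb) //=.
by apply: le; rewrite mxget_ord.
Qed.

End MatrixEntries.

(** [P u v] says that the product of [u] and [v] lies outside the ideal. This is the common form to
    which fractal functions and bilex ideals are both reduced. *)
Definition lex_standard n m (P : 'X_{1..n} -> 'X_{1..m} -> bool)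
    (H : nat -> nat -> nat) :=
  [/\ P 0%MM 0%MM, forall v, lex_closed (P^~ v), forall u, lex_closed (P u)
    & forall i j, H i j = \sum_(u <- mons n i) \sum_(v <- mons m j) P u v].

Lemma fractal_lex_standard n m (H : nat -> nat -> nat) : 0 < n -> 0 < m ->
  fractal n m H <-> exists P, @lex_standard n m P H.
Proof.
move=> n0 m0.
have sz p i : 0 < p -> size (bracket_exp p i) = 'C(i + p.-1, p.-1).
  by move=> p0; rewrite bracket_expE size_map size_mons.
have sm p i : 0 < p -> sumn (bracket_exp p i) = 'C(i.+1 + p.-1, p.-1).
  by move=> p0; rewrite sumn_bracket_exp sz.
split=> [[H00 [M [FM rowM colM]]]|[P [P00 lexl lexr PH]]].
  (* Each pair of monomials is looked up in the matrix of its own bidegree, at its positions in the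
     increasing lists. *)
  pose P (u : 'X_{1..n}) (v : 'X_{1..m}) :=
    mxget (M (mdeg u) (mdeg v)) (index u (mons n (mdeg u))) (index v (mons m (mdeg v))).
  have PE i j r t : r < size (mons n i) -> t < size (mons m j) ->
      P (nth 0%MM (mons n i) r) (nth 0%MM (mons m j) t) = mxget (M i j) r t.
    move=> ri tj; rewrite /P (mdeg_mons (mem_nth _ ri)) (mdeg_mons (mem_nth _ tj)).
    by rewrite !index_uniq ?mons_uniq.
  have PH i j : H i j = \sum_(u <- mons n i) \sum_(v <- mons m j) P u v.
    rewrite -(FM i j).2 (big_nth 0%MM) big_mkord size_mons //; apply: eq_bigr => s _.
    rewrite (big_nth 0%MM) big_mkord size_mons //; apply: eq_bigr => t _.
    by rewrite PE ?size_mons // mxget_ord.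
  exists P; split=> //.
  - by have := PH 0 0; rewrite H00 /= !big_seq1; case: (P _ _).
  - move=> v; pose j := mdeg v; have vj : v \in mons m j by rewrite mem_mons.
    rewrite -(nth_index 0%MM vj).
    have lt : index v (mons m j) < size (mons m j) by rewrite index_mem.
    apply/lex_closed_nthP; split=> [d r r' rr' r'd|d r rd].
      rewrite !PE ?(leq_ltn_trans rr') //.
      exact: (ferrers_mxget (FM _ _).1).
    (* [PE] needs the parent's position to be in range, which holds because the entries of $[n]^d$
       sum to the number of monomials of degree $d+1$. *)
    rewrite !PE //; last first.
      rewrite size_mons // -sz // reshape_indexP // sm // -size_mons //.
    by apply: (mx_le_row_expandP _ _ _ _).1; rewrite ?sz ?sm.
  - move=> u; pose i := mdeg u; have ui : u \in mons n i by rewrite mem_mons.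
    rewrite -(nth_index 0%MM ui).
    have lt : index u (mons n i) < size (mons n i) by rewrite index_mem.
    apply/lex_closed_nthP; split=> [d r r' rr' r'd|d r rd].
      rewrite !PE ?(leq_ltn_trans rr') //.
      exact: (ferrers_mxget (FM _ _).1).
    rewrite !PE //; last first.
      rewrite size_mons // -sz // reshape_indexP // sm // -size_mons //.
    by apply: (mx_le_col_expandP _ _ _ _).1; rewrite ?sz ?sm.
split; first by rewrite PH /= !big_seq1 P00.
pose M i j : 'M[bool]_('C(i + n.-1, n.-1), 'C(j + m.-1, m.-1)) :=
  (\matrix_(s, t) P (nth 0%MM (mons n i) s) (nth 0%MM (mons m j) t))%R.
exists M.
have lt p i (s : 'I_('C(i + p.-1, p.-1))) : 0 < p -> s < size (mons p i).
  by move=> p0; rewrite size_mons.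
have lx v := (lex_closed_nthP _).2 (lexl v).
have ly u := (lex_closed_nthP _).2 (lexr u).
have get i j r t : mxget (M i j) r t =
    [&& r < size (mons n i), t < size (mons m j)
      & P (nth 0%MM (mons n i) r) (nth 0%MM (mons m j) t)].
  rewrite /mxget !size_mons //.
  case: insubP => [s -> <-|/negbTE->//]; case: insubP => [t' -> <-|/negbTE->//].
  by rewrite mxE.
split=> i j.
- split=> [s s' t t' ss tt|]; rewrite ?mxE.
    move=> /((ly _).1 _ _ _ tt (lt _ _ _ m0)).
    exact: ((lx _).1 _ _ _ ss (lt _ _ _ n0)).
  rewrite PH (big_nth 0%MM) big_mkord size_mons //; apply: eq_bigr => s _.
  rewrite (big_nth 0%MM) big_mkord size_mons //; apply: eq_bigr => t _.
  by rewrite mxE.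
- apply/mx_le_row_expandP; rewrite ?sz ?sm // => r t; rewrite !get => /and3P[ri -> Prt].
  by rewrite (lx _).2 // size_mons // -sz // reshape_indexP // sm // -size_mons.
- apply/mx_le_col_expandP; rewrite ?sz ?sm // => r t; rewrite !get => /and3P[-> tj Prt].
  by rewrite (ly _).2 // size_mons // -sz // reshape_indexP // sm // -size_mons.
Qed.

(** * Monomial ideals *)

Section SplitMonomials.
Variables n m : nat.
Implicit Types (u : 'X_{1..n}) (v : 'X_{1..m}) (w : 'X_{1..n + m}).

Definition join u v : 'X_{1..n + m} :=
  [multinom match split i with inl s => u s | inr t => v t end | i < n + m].

Definition lpart w : 'X_{1..n} := [multinom w (lshift m s) | s < n].
Definition rpart w : 'X_{1..m} := [multinom w (rshift n t) | t < m].

Lemma join_lshift u v s : join u v (lshift m s) = u s.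
Proof. by rewrite mnmE (unsplitK (inl s)). Qed.

Lemma join_rshift u v t : join u v (rshift n t) = v t.
Proof. by rewrite mnmE (unsplitK (inr t)). Qed.

Lemma lpart_join u v : lpart (join u v) = u.
Proof. by apply/mnmP => s; rewrite mnmE join_lshift. Qed.

Lemma rpart_join u v : rpart (join u v) = v.
Proof. by apply/mnmP => t; rewrite mnmE join_rshift. Qed.

Lemma join_parts w : join (lpart w) (rpart w) = w.
Proof. by apply/mnmP => i; rewrite mnmE; case: split_ordP => j ->; rewrite mnmE. Qed.

Lemma joinD u u' v v' : (join u v + join u' v')%MM = join (u + u')%MM (v + v')%MM.
Proof.
by apply/mnmP => i; rewrite mnmDE; case: (split_ordP i) => j ->;
  rewrite ?join_lshift ?join_rshift mnmDE.
Qed.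

Lemma lpart0 : lpart 0%MM = 0%MM.
Proof. by apply/mnmP => s; rewrite !mnmE. Qed.

Lemma rpart0 : rpart 0%MM = 0%MM.
Proof. by apply/mnmP => s; rewrite !mnmE. Qed.

Lemma lpartD w w' : lpart (w + w')%MM = (lpart w + lpart w')%MM.
Proof. by rewrite -{1}(join_parts w) -{1}(join_parts w') joinD lpart_join. Qed.

Lemma rpartD w w' : rpart (w + w')%MM = (rpart w + rpart w')%MM.
Proof. by rewrite -{1}(join_parts w) -{1}(join_parts w') joinD rpart_join. Qed.

Lemma bideg_parts w : bideg w = (mdeg (lpart w), mdeg (rpart w)).
Proof. by rewrite !mdegE; congr pair; apply: eq_bigr => i _; rewrite mnmE. Qed.

Lemma bideg_join u v : bideg (join u v) = (mdeg u, mdeg v).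
Proof. by rewrite bideg_parts lpart_join rpart_join. Qed.

Lemma mdeg_join u v : mdeg (join u v) = mdeg u + mdeg v.
Proof.
by rewrite mdegE big_split_ord /= !mdegE; congr (_ + _); apply: eq_bigr => i _;
  rewrite ?join_lshift ?join_rshift.
Qed.

Lemma join_ltl u u' v : mdeg u = mdeg u' -> (u < u')%O -> (join u v < join u' v)%O.
Proof.
move=> du /(ltmcP du)[s eqs lts]; apply/ltmcP; first by rewrite !mdeg_join du.
exists (lshift m s); last by rewrite !join_lshift.
move=> i; case: (split_ordP i) => j -> /= js; rewrite ?join_lshift ?join_rshift //.
exact: eqs.
Qed.

Lemma join_ltr u v v' : mdeg v = mdeg v' -> (v < v')%O -> (join u v < join u v')%O.
Proof.
move=> dv /(ltmcP dv)[s eqs lts]; apply/ltmcP; first by rewrite !mdeg_join dv.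
exists (rshift n s); last by rewrite !join_rshift.
move=> i; case: (split_ordP i) => j -> /= js; rewrite ?join_lshift ?join_rshift //.
by apply: eqs; rewrite ltn_add2l in js.
Qed.

Lemma lpart_le w w' : mdeg (lpart w) = mdeg (lpart w') -> rpart w = rpart w' ->
  (w < w')%O -> (lpart w <= lpart w')%O.
Proof.
move=> dl er ww'; rewrite leNgt; apply/negP => /(join_ltl (rpart w) (esym dl)).
by rewrite join_parts {1}er join_parts ltNge (ltW ww').
Qed.

Lemma rpart_le w w' : mdeg (rpart w) = mdeg (rpart w') -> lpart w = lpart w' ->
  (w < w')%O -> (rpart w <= rpart w')%O.
Proof.
move=> dr el ww'; rewrite leNgt; apply/negP => /(join_ltr (lpart w) (esym dr)).
by rewrite join_parts {1}el join_parts ltNge (ltW ww').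
Qed.

Definition bimons i j : seq 'X_{1..n + m} :=
  [seq join u v | u <- mons n i, v <- mons m j].

Lemma bimons_uniq i j : uniq (bimons i j).
Proof.
apply: allpairs_uniq; rewrite ?mons_uniq // => -[u v] [u' v'] _ _ /= e.
congr pair; first by rewrite -(lpart_join u v) e lpart_join.
by rewrite -(rpart_join u v) e rpart_join.
Qed.

Lemma mem_bimons i j w : (w \in bimons i j) = (bideg w == (i, j)).
Proof.
rewrite bideg_parts; apply/allpairsP/andP => /= [[[u v] /= [ui vj ->]]|[wi wj]].
  by rewrite lpart_join rpart_join -!mem_mons.
by exists (lpart w, rpart w); rewrite /= !mem_mons join_parts.
Qed.

Lemma count_bimons (Q : pred 'X_{1..n + m}) i j :
  count Q (bimons i j) = \sum_(u <- mons n i) \sum_(v <- mons m j) Q (join u v).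
Proof.
rewrite -sum1_count big_mkcond big_allpairs_dep; apply: eq_bigr => u _.
by apply: eq_bigr => v _; case: (Q _).
Qed.

End SplitMonomials.

(** * Dimensions and spans of sets of monomials *)

Section Dimension.
Local Open Scope ring_scope.
Import GRing.Theory.

(** Expressing two bases in each other gives matrices whose product is the identity of size [e] and
    factors through size [e'], so [e] is at most [e']; then use symmetry. *)
Lemma has_dim_uniq (K : fieldType) (V : lmodType K) (A : {pred V}) d d' :
  has_dim A d -> has_dim A d' -> d = d'.
Proof.
have le e e' : has_dim A e -> has_dim A e' -> (e <= e')%N.
  move=> [b [Ab bfree]] [b' [Ab' _]].
  have bA i : b i \in A.
    apply/Ab; exists (fun l => (l == i)%:R); rewrite (bigD1 i) //= eqxx scale1r.
    by rewrite big1 ?addr0 // => l /negbTE->; rewrite scale0r.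
  have b'A i : b' i \in A.
    apply/Ab'; exists (fun l => (l == i)%:R); rewrite (bigD1 i) //= eqxx scale1r.
    by rewrite big1 ?addr0 // => l /negbTE->; rewrite scale0r.
  have /fin_all_exists[C CE] i : exists c : 'I_e' -> K, b i = \sum_l c l *: b' l.
    by apply/Ab'.
  have /fin_all_exists[D DE] i : exists c : 'I_e -> K, b' i = \sum_l c l *: b l.
    by apply/Ab.
  apply: (@mulmx1_min _ _ _ (\matrix_(i, l) C i l) (\matrix_(l, i) D l i)).
  apply/matrixP => i.
  (* These are the coefficients of [b i] expanded through [b'] and back, minus those of [b i]
     itself; their combination of the [b l] vanishes, and freeness applies. *)
  pose c l := ((\matrix_(i, l) C i l) *m (\matrix_(l, i) D l i)) i l - 1%:M i l.
  suff c0 : \sum_l c l *: b l = 0.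
    by move=> l; apply/eqP; rewrite -subr_eq0; apply/eqP/(bfree c c0).
  rewrite /c; under eq_bigr do rewrite scalerBl.
  rewrite sumrB (bigD1 i (F := fun l => 1%:M i l *: _)) //=.
  rewrite [X in _ - (_ + X)]big1 => [|l /negbTE il]; last first.
    by rewrite mxE eq_sym il scale0r.
  rewrite mxE eqxx scale1r addr0 [X in _ - X]CE; apply/eqP; rewrite subr_eq0; apply/eqP.
  under eq_bigr do rewrite mxE scaler_suml.
  rewrite exchange_big; apply: eq_bigr => l _; rewrite DE scaler_sumr.
  by apply: eq_bigr => p _; rewrite !mxE scalerA.
by move=> Ad Ad'; apply/eqP; rewrite eqn_leq !le.
Qed.

Variables k : fieldType.

Lemma has_dim_msupp N (A : {pred {mpoly k[N]}}) (S : seq 'X_{1..N}) : uniq S ->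
  (forall p, (p \in A) = all (mem S) (msupp p)) -> has_dim A (size S).
Proof.
move=> US AS; pose b i : {mpoly k[N]} := 'X_[tnth (in_tuple S) i].
have coef (c : 'I_(size S) -> k) i : (\sum_l c l *: b l)@_(tnth (in_tuple S) i) = c i.
  rewrite raddf_sum (bigD1 i) //= mcoeffZ mcoeffX eqxx mulr1 big1 ?addr0 // => l li.
  rewrite mcoeffZ mcoeffX; case: eqP => [e|]; rewrite ?mulr0 //; case/eqP: li.
  apply/val_inj/eqP; rewrite -(nth_uniq 0%MM (ltn_ord l) (ltn_ord i) US).
  by rewrite -!(tnth_nth _ (in_tuple S)) e.
exists b; split=> [p|c c0 i]; last by rewrite -coef c0 mcoeff0.
rewrite AS; split=> [/allP pS|[c ->]].
  exists (fun i => p@_(tnth (in_tuple S) i)); apply/mpolyP => w.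
  have [wS|wS] := boolP (w \in S).
    by have /tnthP[i ->] : w \in in_tuple S by []; rewrite coef.
  have -> : p@_w = 0 by apply: memN_msupp_eq0; apply: contra wS => /pS.
  rewrite raddf_sum big1 // => i _ /=; rewrite mcoeffZ mcoeffX.
  by case: eqP => [e|]; rewrite ?mulr0 //; rewrite -e mem_tnth in wS.
apply/allP => w; apply: contraLR => wS; rewrite mcoeff_msupp negbK raddf_sum.
rewrite big1 // => i _ /=; rewrite mcoeffZ mcoeffX.
by case: eqP => [e|]; rewrite ?mulr0 //; rewrite /= -e mem_tnth in wS.
Qed.

Lemma in_span_monomials n m (L : 'X_{1..n + m} -> Prop) (p : {mpoly k[n + m]}) :
  in_span (monomials_in L) p <-> {in msupp p, forall w, L w}.
Proof.
split=> [[s [sL ->]]|pL].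
  elim: s sL => [|[c q] s IHs] sL w; first by rewrite big_nil msupp0.
  rewrite big_cons /= => /msuppD_le; rewrite mem_cat => /orP[|].
    have /= [u Lu ->] := sL _ (mem_head _ _).
    rewrite mcoeff_msupp mcoeffZ mcoeffX.
    by have [<-|] := eqVneq u w; rewrite ?mulr0 ?eqxx.
  by apply: IHs => x xs; apply: sL; rewrite inE xs orbT.
exists [seq (p@_w, 'X_[w]) | w <- msupp p]; split; last by rewrite big_map -mpolyE.
by move=> _ /mapP[w wp ->]; exists w => //=; apply: pL.
Qed.

End Dimension.

Section MonomialIdeals.
Local Open Scope ring_scope.
Import GRing.Theory.
Variables (k : fieldType) (n m : nat) (I : {pred {mpoly k[n + m]}}).
Variable Q : pred 'X_{1..n + m}.
(* Q is the set of standard monomials of I. *)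
Hypothesis IQ : forall p, (p \in I) = all (predC Q) (msupp p).

(** The monomials of bidegree $(i,j)$ form a basis of $R_{(i,j)}$, those failing [Q] a basis of
    $I_{(i,j)}$, and the difference counts the standard ones. Uniqueness of dimension handles
    arbitrary witnesses in the definition. *)
Lemma hilbert_function_count H : is_hilbert_function I H <->
  forall i j, H i j = count Q (bimons n m i j).
Proof.
have dimR i j : has_dim (@bihomog k n m i j) (size (bimons n m i j)).
  apply: has_dim_msupp (bimons_uniq _ _ _ _) _ => p.
  by apply: eq_all => w; rewrite -mem_bimons.
have dimI i j : has_dim (ideal_part I i j) (count (predC Q) (bimons n m i j)).
  rewrite -size_filter; apply: has_dim_msupp => [|p].
    by rewrite filter_uniq ?bimons_uniq.
  rewrite inE IQ inE -all_predI; apply: eq_all => w /=.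
  by rewrite mem_filter /= mem_bimons.
have QE i j : count Q (bimons n m i j) =
    (size (bimons n m i j) - count (predC Q) (bimons n m i j))%N.
  by rewrite -(count_predC Q) addnK.
split=> HI i j.
  have [dR [dI [hR hI ->]]] := HI i j.
  by rewrite QE (has_dim_uniq hR (dimR i j)) (has_dim_uniq hI (dimI i j)).
by exists (size (bimons n m i j)), (count (predC Q) (bimons n m i j)); rewrite HI QE.
Qed.

End MonomialIdeals.

(** * Bilex ideals versus sets of standard monomials *)

Section Equivalence.
Local Open Scope ring_scope.
Import GRing.Theory.
Variables (k : fieldType) (n m : nat) (H : nat -> nat -> nat).

Lemma lex_closed_addr N (A : pred 'X_{1..N}) u u' :
  lex_closed A -> A (u + u')%MM -> A u.
Proof.
move=> [_ step]; have [d] := ubnP (mdeg u'); elim: d u' => // d IHd u' du'.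
have [->|u0] := eqVneq u' 0%MM; first by rewrite addm0.
have [w [l [e _]]] := top_factor u0; rewrite e addmA => /step; apply: IHd.
by rewrite e mdegD mdeg1 addn1 in du'.
Qed.

Lemma lex_standard_bilex P : @lex_standard n m P H ->
  exists I : {pred {mpoly k[n + m]}}, bilex_ideal I /\ is_hilbert_function I H.
Proof.
move=> [P00 lexl lexr PH]; pose Q w := P (lpart w) (rpart w).
(* The ideal consists of the polynomials without standard monomials in their support. *)
pose I : {pred {mpoly k[n + m]}} := [pred p | all (predC Q) (msupp p)].
have IQ p : (p \in I) = all (predC Q) (msupp p) by [].
have I0 : 0 \in I by rewrite IQ msupp0.
have IDM (a p q : {mpoly k[n + m]}) : p \in I -> q \in I -> a * p + q \in I.
  move=> /allP pI /allP qI; apply/allP => w /msuppD_le.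
  rewrite mem_cat => /orP[|/qI//] /msuppM_le/allpairsP[[u v] /= [_ /pI vQ ->]].
  apply: contra vQ; rewrite /Q lpartD rpartD addmC [(rpart u + _)%MM]addmC.
  move=> /(lex_closed_addr (lexl _)); exact: (lex_closed_addr (lexr _)).
exists I; split; last first.
  apply/(hilbert_function_count IQ) => i j; rewrite PH count_bimons.
  by apply: eq_bigr => u _; apply: eq_bigr => v _; rewrite /Q lpart_join rpart_join.
split.
- by split=> [//||a p q]; [rewrite IQ msupp1 /= /Q lpart0 rpart0 P00 | apply: IDM].
- exists (fun w => ~~ Q w) => p; split=> [/allP pI|[s [sG ->]]].
    (* Scalars over [R^o] are polynomials, so the coefficients enter as constants. *)
    exists [seq ((p@_w)%:MP, 'X_[w] : {mpoly k[n + m]}^o) | w <- msupp p]; split.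
      by move=> _ /mapP[w wp ->]; exists w => //; apply: pI.
    rewrite big_map [LHS]mpolyE; apply: eq_bigr => w _ /=.
    by rewrite -mul_mpolyC.
  elim: s sG => [|[c q] s IHs] sG; first by rewrite big_nil.
  rewrite big_cons; apply: IDM; last first.
    by apply: IHs => x xs; apply: sG; rewrite inE xs orbT.
  by have /= [w wQ ->] := sG _ (mem_head _ _); rewrite IQ msuppX /= wQ.
- move=> i j; exists (fun w => bideg w = (i, j) /\ ~~ Q w).
    split=> [w []//|u v bu bv [buv uvQ]].
    move: bu bv buv uvQ; rewrite !bideg_parts => -[ui u0] [v0 vj] _.
    (* The bidegrees force [rpart u] and [lpart v] to be trivial, so [u + v] has parts [lpart u] and
       [rpart v]. *)
    have r0 (w : 'X_{1..n + m}) : mdeg (rpart w) = 0%N -> rpart w = 0%MM.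
      by move/eqP; rewrite mdeg_eq0 => /eqP.
    have l0 (w : 'X_{1..n + m}) : mdeg (lpart w) = 0%N -> lpart w = 0%MM.
      by move/eqP; rewrite mdeg_eq0 => /eqP.
    rewrite /Q !lpartD !rpartD (r0 u) // (l0 v) // addm0 add0m => uvQ.
    split=> [u'|v']; rewrite !bideg_parts => -[du dv] lt.
      rewrite lpartD rpartD (r0 u') // (l0 v) // addm0 add0m du vj; split=> //.
      apply: contra uvQ; apply: (lexl _).1; first by rewrite ui du.
      by apply: lpart_le lt; rewrite ?ui // (r0 u) // (r0 u').
    rewrite lpartD rpartD (r0 u) // (l0 v') // addm0 add0m ui dv; split=> //.
    apply: contra uvQ; apply: (lexr _).1; first by rewrite vj dv.
    by apply: rpart_le lt; rewrite ?vj // (l0 v) // (l0 v').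
  move=> p; rewrite in_span_monomials inE; split=> [/andP[/allP pI /allP pb] w wp|pL].
    by split; [apply/eqP/pb | apply: pI].
  by apply/andP; split; apply/allP => w /pL[/eqP].
Qed.

Lemma bilex_lex_standard (I : {pred {mpoly k[n + m]}}) :
    bilex_ideal I -> is_hilbert_function I H ->
  lex_standard (fun u v => 'X_[join u v] \notin I) H.
Proof.
move=> [[I0 I1 IDM] [G IG] bilexI] HI.
have IM a p : p \in I -> a * p \in I by move=> pI; rewrite -[a * p]addr0 IDM.
have GI g : G g -> 'X_[g] \in I.
  move=> Gg; apply/IG; exists [:: (1, 'X_[g])]; rewrite big_seq1 scale1r; split=> // x.
  by rewrite inE => /eqP->; exists g.
(* Every monomial in the support of an element of [I] is a multiple of some generator, hence itself
   in [I]. *)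
have IQ p : (p \in I) = all (predC (fun w => 'X_[w] \notin I)) (msupp p).
  apply/idP/allP => [/IG[s [sG ->]] w|pI].
    elim: s sG => [|[c q] s IHs] sG; first by rewrite big_nil msupp0.
    rewrite big_cons => /msuppD_le; rewrite mem_cat => /orP[|]; last first.
      by apply: IHs => x xs; apply: sG; rewrite inE xs orbT.
    have /= [g Gg ->] := sG _ (mem_head _ _).
    move=> /msuppM_le/allpairsP[[u v] /= [_]]; rewrite msuppX inE => /eqP-> ->.
    by rewrite negbK mpolyXD IM ?GI.
  rewrite (mpolyE p) big_seq; elim/big_ind: _ => // [q r qI rI|w /pI].
    by rewrite -[q]mul1r IDM.
  by rewrite /= negbK -mul_mpolyC; apply: IM.
(* A single monomial lies in the span of a set of monomials only as a member of it, so implications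
   about bilex sets transfer to [I]. *)
have lexI u v u' v' :
    (forall L, bilex_set (mdeg u) (mdeg v) L ->
       L (join u v) -> L (join u' v')) ->
    'X_[join u v] \in I -> 'X_[join u' v'] \in I.
  move=> bl uvI; have [L bL LI] := bilexI (mdeg u) (mdeg v).
  have : 'X_[join u' v'] \in ideal_part I (mdeg u) (mdeg v).
    apply/LI/in_span_monomials => w; rewrite msuppX inE => /eqP->; apply: bl => //.
    have : 'X_[join u v] \in ideal_part I (mdeg u) (mdeg v).
      by rewrite inE uvI inE msuppX /= bideg_join eqxx.
    by move=> /LI/in_span_monomials; apply; rewrite msuppX mem_head.
  by case/andP.
(* The definition of bilex sets speaks of products of a pure x-monomial and a pure y-monomial, so
   [join u v] is rewritten in that form. *)
have joinE (u : 'X_{1..n}) (v : 'X_{1..m}) :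
    join u v = (join u 0 + join 0 v)%MM
  by rewrite joinD addm0 add0m.
have j0 : join 0 0 = 0%MM :> 'X_{1..n + m}.
  by rewrite -(lpart0 n m) -(rpart0 n m) join_parts.
split.
- by rewrite j0 mpolyX0.
- move=> v; split=> [u u' du|u l]; last first.
    rewrite -(addm0 v) -joinD mpolyXD mulrC addm0.
    by apply: contra; apply: IM.
  rewrite le_eqVlt => /predU1P[->//|uu']; apply: contra.
  apply: lexI => L [_ bL].
  rewrite (joinE u') (joinE u) => Luv.
  by apply: (bL _ _ _ _ Luv).1; rewrite ?bideg_join ?mdeg0 ?du // join_ltl.
- move=> u; split=> [v v' dv|v l]; last first.
    rewrite -(addm0 u) -joinD mpolyXD mulrC addm0.
    by apply: contra; apply: IM.
  rewrite le_eqVlt => /predU1P[->//|vv']; apply: contra.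
  apply: lexI => L [_ bL].
  rewrite (joinE u v') (joinE u v) => Luv.
  by apply: (bL _ _ _ _ Luv).2; rewrite ?bideg_join ?mdeg0 ?dv // join_ltr.
- by move=> i j; rewrite ((hilbert_function_count IQ H).1 HI) count_bimons.
Qed.

End Equivalence.

Theorem theorem4p12 (k : fieldType) (hk : infinite_field k) (n m : nat)
    (hn : 1 <= n) (hm : 1 <= m) (H : nat -> nat -> nat) :
  fractal n m H <->
  exists I : {pred {mpoly k[n + m]}}, bilex_ideal I /\ is_hilbert_function I H.
Proof.
rewrite fractal_lex_standard //; split=> [[P PH]|[I [bI HI]]].
  exact: lex_standard_bilex PH.
by exists (fun u v => ('X_[join u v] \notin I)%R); apply: bilex_lex_standard.
Qed.
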